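(* Let $H$ be a $3$-graph on $n$ vertices with $\delta_2(H) > 7n/9$. Then the tetrahedral graph $\mathcal{T}(H)$ is tightly connected.
   Context: A $k$-graph $H$ consists of a finite vertex set $V(H)$ and a set $E(H)$ of $k$-element subsets of $V(H)$ (edges). For a $3$-graph $H$, the minimum codegree $\delta_2(H)$ is the largest $m$ such that every pair of distinct vertices of $H$ is contained in at least $m$ edges. $K_4^3$ is the complete $3$-graph on four vertices. The tetrahedral graph $\mathcal{T}(H)$ of a $3$-graph $H$ is the $4$-graph with vertex set $V(H)$ whose edges are all sets of four vertices which induce a copy of $K_4^3$ in $H$. For a $k$-graph $G$ and edges $e,f \in E(G)$, a tight walk from $e$ to $f$ in $G$ is a sequence of (not necessarily distinct) vertices $(v_1,\dots,v_\ell)$ with $e = \{v_1,\dots,v_k\}$, $f = \{v_{\ell-k+1},\dots,v_\ell\}$ and $\{v_i,\dots,v_{i+k-1}\} \in E(G)$ for each $1 \le i \le \ell-k+1$. The $k$-graph $G$ is tightly connected if for all $e,f \in E(G)$ there exists a tight walk from $e$ to $f$ in $G$. *)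

(* Defs.v *)
From mathcomp Require Import all_boot.

Set Implicit Arguments.
Unset Strict Implicit.
Unset Printing Implicit Defensive.

Record kgraph (k : nat) (V : finType) := KGraph {
  edges : {set {set V}};
  edges_uniform : [forall e in edges, #|e| == k]
}.

Definition codegree (V : finType) (H : kgraph 3 V) (x y : V) : nat :=
  #|[set e in edges H | [set x; y] \subset e]|.

Definition codegree_ge (V : finType) (H : kgraph 3 V) (m : nat) : bool :=
  [forall x, forall y, (x != y) ==> (m <= codegree H x y)].

(* The largest [m] with [codegree_ge H m].  The search bound [m <= #|V|] loses
   nothing when there are two distinct vertices, see [min_codegreeP].  With
   fewer than two vertices every [m] qualifies, there is no largest one, and
   the value is #|V| by convention. *)
Definition min_codegree (V : finType) (H : kgraph 3 V) : nat :=
  \max_(m < #|V|.+1 | codegree_ge H m) m.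

Definition complete_edges (V : finType) (k : nat) (S : {set V}) :
    {set {set V}} :=
  [set e : {set V} | (e \subset S) && (#|e| == k)].

Definition induced_edges (k : nat) (V : finType) (G : kgraph k V)
    (S : {set V}) : {set {set V}} :=
  [set e in edges G | e \subset S].

Definition tetrahedral_edges (V : finType) (H : kgraph 3 V) : {set {set V}} :=
  [set S : {set V} | (#|S| == 4) &&
                     (induced_edges H S == complete_edges 3 S)].

Lemma tetrahedral_uniform (V : finType) (H : kgraph 3 V) :
  [forall S in tetrahedral_edges H, #|S| == 4].
Proof. by apply/forall_inP => S; rewrite inE => /andP[]. Qed.

Definition tetrahedral (V : finType) (H : kgraph 3 V) : kgraph 4 V :=
  KGraph (tetrahedral_uniform H).

(* The k consecutive entries of [w] starting at (0-based) position [i]. *)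
Definition window (k : nat) (V : finType) (w : seq V) (i : nat) : {set V} :=
  [set x in take k (drop i w)].

Definition tight_walk (k : nat) (V : finType) (G : kgraph k V)
    (e f : {set V}) (w : seq V) : Prop :=
  [/\ k <= size w,
      e = window k w 0,
      f = window k w (size w - k)
    & forall i : nat, i <= size w - k -> window k w i \in edges G].

Definition tightly_connected (k : nat) (V : finType) (G : kgraph k V) : Prop :=
  forall e f : {set V}, e \in edges G -> f \in edges G ->
    exists w : seq V, tight_walk G e f w.

Lemma codegree_le (V : finType) (H : kgraph 3 V) (x y : V) :
  x != y -> codegree H x y <= #|V|.
Proof.
move=> xy; pose g (z : V) : {set V} := [set x; y; z].
rewrite -cardsT; apply: leq_trans (leq_imset_card g [set: V]).
apply/subset_leq_card/subsetP => e; rewrite inE => /andP[He sub].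
have /eqP ce : #|e| == 3 by move/forall_inP: (edges_uniform H); apply.
have : #|e :\: [set x; y]| = 1.
  by rewrite cardsD (setIidPr sub) ce cards2 xy.
move=> /eqP/cards1P[z Ez]; apply/imsetP; exists z => //.
by rewrite /g -(setID e [set x; y]) Ez (setIidPr sub).
Qed.

Lemma min_codegreeP (V : finType) (H : kgraph 3 V) (m : nat) :
  1 < #|V| -> (m <= min_codegree H) = codegree_ge H m.
Proof.
move=> V2; apply/idP/idP => [le_m|Hm]; last first.
  have [x [y [_ _ xy]]] : exists x y, [/\ x \in V, y \in V & x != y].
    by apply/card_gt1P.
  have mV : m < #|V|.+1.
    move/forallP/(_ x)/forallP/(_ y)/implyP/(_ xy): Hm => /leq_trans.
    by rewrite ltnS; apply; apply: codegree_le.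
  exact: (@leq_bigmax_cond _ _ (fun i : 'I_#|V|.+1 => i : nat) (Ordinal mV)).
have : codegree_ge H (min_codegree H).
  rewrite /min_codegree; elim/big_ind: _ => [|a b Ha Hb|//].
    by apply/forallP => x; apply/forallP => y; apply/implyP.
  by rewrite /maxn; case: ifP.
move=> /forallP Hd; apply/forallP => x; apply/forallP => y; apply/implyP => xy.
exact: leq_trans le_m (implyP (forallP (Hd x) y) xy).
Qed.

(* Main.v *)
Require Import Defs.
From mathcomp Require Import all_boot all_order all_algebra.
From mathcomp Require Import zify.

(** Two tetrahedra sharing a triple are joined by a tight walk, and rotating
    the last window of a walk lets any of its vertices be dropped next
    ([tight_walk_step]).  So it suffices to connect any two tetrahedra by steps
    of this kind.  Colour an edge of [H] [true] when it lies in a tetrahedron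
    reachable from a fixed one, and [false] otherwise: the four triples of a
    tetrahedron then have the same colour, and the claim is that both colours
    cannot occur ([one_colour]).

    Measure vertex sets in units of |V|.  Every pair is in edges with more than
    7/9 of the vertices, so an edge [xyz] extends to a tetrahedron in more than
    3 * 7/9 - 2 = 1/3 of all ways, and a colour that occurs at a pair occurs
    there for more than 1/3 of the vertices.  If no pair sees both colours, the
    colour of a pair passes to every pair meeting it, hence to all edges.  So
    let some pair see both colours; then each colour has less than 4/9 there,
    because a third vertex [b] of the other colour has no common tetrahedron
    with the first colour ([cdeg_ub]).

    Call [xyr], [xyb], [xrb] a mixed configuration if the first edge has colour
    k and the other two the opposite colour (then [yrb] is not an edge).
    Counting, for each vertex w, how many pairs of the configuration it extends
    to an edge shows that the three pairs of [xyr] see both colours while the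
    three pairs at [b] see only one ([mixed_bicol3], [mixed_base]).
    Consequently, at a pair [xy] with both colours, one of the two colours k
    has the property that every edge [xyz] of colour k has all its pairs
    two-coloured ([bicol3_exists], [bicol3_spread]). This property is
    inherited by the pairs of [xyz], so that one can grow five vertices all
    of whose triples have colour k and all of whose ten pairs see both
    colours.

    Five such vertices contradict the degrees ([no_bicol]).  For a vertex w
    consider the pairs of the five that w extends to an edge: a triangle of
    such pairs spans a tetrahedron with w, so its three extensions have colour
    k.  A graph on five vertices with h edges, r of which lie in triangles,
    satisfies 5 h <= 30 + 2 r ([forced_links5]).  Summing over w, the left side
    exceeds 50 * 7/9 = 350/9, whereas the right side is below
    30 + 20 * 4/9 = 350/9. *)

Set Implicit Arguments.
Unset Strict Implicit.
Unset Printing Implicit Defensive.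

(** * Mixed configurations and two-coloured pairs *)

(** The ten booleans are the edges of a graph on five points x, y, z, u, v;
    each summand on the right tests whether an edge lies in a triangle.  The
    bound is the linear one through the two extremes: triangle-free graphs with
    six edges, and the complete graph with ten. *)
Lemma forced_links5 (xy xz xu xv yz yu yv zu zv uv : bool) :
  5 * (xy + xz + xu + xv + yz + yu + yv + zu + zv + uv) <=
  30 + 2 * ((xy && [|| xz && yz, xu && yu | xv && yv])
    + (xz && [|| xy && yz, xu && zu | xv && zv])
    + (xu && [|| xy && yu, xz && zu | xv && uv])
    + (xv && [|| xy && yv, xz && zv | xu && uv])
    + (yz && [|| xy && xz, yu && zu | yv && zv])
    + (yu && [|| xy && xu, yz && zu | yv && uv])
    + (yv && [|| xy && xv, yz && zv | yu && uv])
    + (zu && [|| xz && xu, yz && yu | zv && uv])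
    + (zv && [|| xz && xv, yz && yv | zu && uv])
    + (uv && [|| xu && xv, yu && yv | zu && zv])).
Proof.
by case: xy xz xu xv yz yu yv zu zv uv
  => [] [] [] [] [] [] [] [] [] [].
Qed.

Section Colouring.

(** [E k x y z] stands for an edge [xyz] of colour [k].  Together with symmetry,
    [E_mono] says that the four triples of a tetrahedron have one colour. *)
Variables (V : finType) (E : bool -> V -> V -> V -> bool).

Definition edge x y z := E true x y z || E false x y z.
Definition deg x y := \sum_w edge x y w.
Definition cdeg k x y := \sum_w E k x y w.
Definition sees k x y := [exists w, E k x y w].
Definition bicol x y := sees true x y && sees false x y.

Hypothesis E_swap : forall k x y z, E k x y z = E k y x z.
Hypothesis E_swapr : forall k x y z, E k x y z = E k x z y.
Hypothesis E_neq : forall k x y z, E k x y z -> x != y.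
Hypothesis E_disj : forall k x y z, E k x y z -> E (~~ k) x y z = false.
Hypothesis E_mono : forall k x y z w,
  E k x y z -> edge x y w -> edge x z w -> edge y z w -> E k x y w.
Hypothesis deg_gt : forall x y, x != y -> 7 * #|V| < 9 * deg x y.

Lemma edge_swap x y z : edge x y z = edge y x z.
Proof. by rewrite /edge 2!(E_swap _ x). Qed.

Lemma edgeE k x y z : edge x y z = E k x y z || E (~~ k) x y z.
Proof. by case: k; rewrite // orbC. Qed.

Lemma E_edge k x y z : E k x y z -> edge x y z.
Proof. by rewrite (edgeE k) => ->. Qed.

Lemma bicolE k x y : bicol x y = sees k x y && sees (~~ k) x y.
Proof. by case: k; rewrite // andbC. Qed.

Lemma sees_swap k x y : sees k x y = sees k y x.
Proof. by apply: eq_existsb => w; rewrite E_swap. Qed.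

Lemma bicol_swap x y : bicol x y = bicol y x.
Proof. by rewrite /bicol !(sees_swap _ x). Qed.

Lemma seesI k x y z : E k x y z -> sees k x y.
Proof. by move=> h; apply/existsP; exists z. Qed.

Lemma deg_edge k x y z : E k x y z ->
  [/\ 7 * #|V| < 9 * deg x y, 7 * #|V| < 9 * deg x z
    & 7 * #|V| < 9 * deg y z].
Proof.
move=> h; split; apply: deg_gt; first exact: E_neq h.
- by move: h; rewrite E_swapr => /E_neq.
- by move: h; rewrite E_swap E_swapr => /E_neq.
Qed.

(** All counting below goes through this: a bound for each single vertex,
    summed over the vertices. *)
Lemma sum_bound c (F G : V -> nat) :
  (forall w, F w <= c + G w) -> \sum_w F w <= c * #|V| + \sum_w G w.
Proof.
move=> le; rewrite mulnC -sum_nat_const -big_split /=.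
by apply: leq_sum => w _; apply: le.
Qed.

Lemma E_mono3 k x y z w : E k x y z ->
  edge x y w -> edge x z w -> edge y z w ->
  [/\ E k x y w, E k x z w & E k y z w].
Proof.
move=> h hxy hxz hyz; split; first exact: E_mono h _ _ _.
- by apply: (@E_mono k x z y) => //; rewrite 1?E_swapr // edge_swap.
- apply: (@E_mono k y z x) => //; first by rewrite E_swapr E_swap.
  + by rewrite edge_swap.
  + by rewrite edge_swap.
Qed.

Lemma clash k x y z w :
  E k x y z -> E (~~ k) x y w -> ~~ (edge x z w && edge y z w).
Proof.
move=> h hw; apply/negP => /andP[hx hy].
have [h1 _ _] := E_mono3 h (E_edge hw) hx hy.
by rewrite (E_disj h1) in hw.
Qed.

(** Two edges of different colours on a common pair [xy] cannot both be
    completed by w to tetrahedra, since [xyw] would need both colours. *)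
Lemma clash5 k x y z t w : E k x y z -> E (~~ k) x y t ->
  ~~ [&& edge x y w, edge x z w, edge y z w, edge x t w & edge y t w].
Proof.
move=> hz ht; apply/negP => /and5P[hxy hxz hyz hxt hyt].
have [h1 _ _] := E_mono3 hz hxy hxz hyz.
have [h2 _ _] := E_mono3 ht hxy hxt hyt.
by rewrite (E_disj h1) in h2.
Qed.

(** The three pairs of an edge miss less than 2/9 each, and whatever extends
    all three forms a tetrahedron with the edge. *)
Lemma cdeg_lb k x y z : E k x y z -> #|V| < 3 * cdeg k x y.
Proof.
move=> h.
have B : deg x y + deg x z + deg y z <= 2 * #|V| + cdeg k x y.
  rewrite /deg -!big_split /=; apply: sum_bound => w.
  move: (@E_mono3 k x y z w h).
  case: (edge x y w); case: (edge x z w); case: (edge y z w) => //=.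
  by case=> // ->.
have [] := deg_edge h; lia.
Qed.

Lemma sees_lb k x y : sees k x y -> #|V| < 3 * cdeg k x y.
Proof. by case/existsP=> z /cdeg_lb. Qed.

(** For an edge [xyb] of the other colour, no vertex counted by [cdeg k x y]
    is joined to both [xb] and [yb], which together miss less than 4/9. *)
Lemma cdeg_ub k x y : bicol x y -> 9 * cdeg k x y < 4 * #|V|.
Proof.
rewrite (bicolE k) => /andP[_ /existsP[b hb]].
have B : cdeg k x y + deg x b + deg y b <= 2 * #|V| + \sum_(w : V) 0.
  rewrite /deg /cdeg -!big_split /=; apply: sum_bound => w.
  have := @clash (~~ k) x y b w hb; rewrite negbK.
  case: (E k x y w); case: (edge x b w); case: (edge y b w) => //= H.
  by have := H isT.
rewrite big1 // in B.
have [] := deg_edge hb; lia.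
Qed.

(** Three edges through [x] on four vertices, not all of the same colour; the
    edge of the minority colour is [xyr], and [b] is the vertex off it. *)
Definition mixed k x y r b := [/\ E k x y r, E (~~ k) x y b & E (~~ k) x r b].

Lemma mixed_swap k x y r b : mixed k x y r b -> mixed k x r y b.
Proof. by case=> h1 h2 h3; split=> //; rewrite E_swapr. Qed.

Lemma mixed_deg k x y r b : mixed k x y r b ->
  [/\ 7 * #|V| < 9 * deg x y, 7 * #|V| < 9 * deg x r
    & 7 * #|V| < 9 * deg x b] /\
  [/\ 7 * #|V| < 9 * deg y r, 7 * #|V| < 9 * deg y b
    & 7 * #|V| < 9 * deg r b].
Proof.
case=> /deg_edge[? ? ?] /deg_edge[? ? ?] /deg_edge[? ? ?]; by split; split.
Qed.

(** If [xb] also saw colour k, then more than 1/3 of the vertices would extend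
    [xb] in that colour.  Such a w misses a pair of each of the edges [xyb] and
    [xrb], apart from [xb], so at least two of the six pairs; every other w
    misses at least one.  Six degrees above 7/9 exclude that. *)
Lemma mixed_apex k x y r b : mixed k x y r b -> ~~ sees k x b.
Proof.
move=> h; apply/negP => /sees_lb hk.
case: (h) => hr hb hrb.
have B : deg x y + deg x r + deg x b + deg y r + deg y b + deg r b + cdeg k x b
         <= 5 * #|V| + \sum_(w : V) 0.
  rewrite /deg /cdeg -!big_split /=; apply: sum_bound => w.
  have /= C1 := @clash5 k x y r b w hr hb.
  have C2 : E k x b w -> ~~ (edge x y w && edge y b w).
    move=> hw; rewrite (edge_swap y b); apply: (@clash (~~ k)).
      by rewrite E_swapr.
    by rewrite negbK.
  have C3 : E k x b w -> ~~ (edge x r w && edge r b w).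
    move=> hw; rewrite (edge_swap r b); apply: (@clash (~~ k)).
      by rewrite E_swapr.
    by rewrite negbK.
  move: C1 C2 C3; move: (edge x y w) (edge x r w) (edge x b w) (edge y r w)
    (edge y b w) (edge r b w) (E k x b w) => [] [] [] [] [] [] [] //= *;
  by do ?[match goal with h : is_true true -> _ |- _ => have {h} := h isT end].
rewrite big1 // in B.
have [[? ? ?] [? ? ?]] := mixed_deg h; lia.
Qed.

(** Suppose [ybz] and [rbz] had different colours, and consider nine of the ten
    pairs on x, y, r, b, z, leaving out [xz].  Apply [clash5] to the edges
    [xyr] and [xyb], [xyr] and [xrb], [xyb] and [ybz], [ybz] and [rbz]: each
    gives a set of five of these pairs that contains one missed by a given w.
    No single pair lies in all four sets, so w extends at most seven of the
    nine, while the degrees sum to more than 9 * 7/9. *)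
Lemma mixed_agree k x y r b z :
  mixed k x y r b -> E k y b z -> ~~ E (~~ k) r b z.
Proof.
move=> h hy; apply/negP => hz.
case: (h) => hr hb hrb.
have B : deg x y + deg x r + deg x b + deg y r + deg y b + deg r b
         + deg y z + deg r z + deg b z <= 7 * #|V| + \sum_(w : V) 0.
  rewrite /deg -!big_split /=; apply: sum_bound => w.
  have := @clash5 k x y r b w hr hb.
  have : ~~ [&& edge x r w, edge x y w, edge y r w, edge x b w & edge r b w].
    by rewrite (edge_swap y r); apply: (@clash5 k) => //; rewrite E_swapr.
  have : ~~ [&& edge y b w, edge y z w, edge b z w, edge x y w & edge x b w].
    rewrite (edge_swap x y) (edge_swap x b); apply: (@clash5 k) => //.
    by rewrite E_swapr E_swap.
  have : ~~ [&& edge b z w, edge y b w, edge y z w, edge r b w & edge r z w].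
    rewrite (edge_swap y b) (edge_swap r b) (edge_swap y z) (edge_swap r z).
    by apply: (@clash5 k); rewrite E_swapr E_swap.
  by move: (edge x y w) (edge x r w) (edge x b w) (edge y r w) (edge y b w)
    (edge r b w) (edge y z w) (edge r z w) (edge b z w)
    => [] [] [] [] [] [] [] [] [].
rewrite big1 // in B.
have [[? ? ?] [? ? ?]] := mixed_deg h.
have [_ ? ?] := deg_edge hy; have [_ ? _] := deg_edge hz; lia.
Qed.

(** Same count as in [mixed_apex], with [rb] in place of [xb] as the pair
    assumed to see k, and [xb] counted twice.  When w extends [rb] in colour k,
    [mixed_agree] forces the colour of [ybw] to be k as well, which produces the
    clashes with [xyb]. *)
Lemma mixed_base k x y r b : mixed k x y r b -> ~~ sees k r b.
Proof.
move=> h; apply/negP => /sees_lb hk.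
case: (h) => hr hb hrb.
have B : deg x y + deg x r + 2 * deg x b + deg y r + deg y b + cdeg k r b
         <= 5 * #|V| + \sum_(w : V) 0.
  rewrite /deg /cdeg big_distrr -!big_split /=; apply: sum_bound => w.
  have := @clash5 k x y r b w hr hb.
  have : E k r b w -> ~~ (edge x r w && edge x b w).
    move=> hw; rewrite (edge_swap x r) (edge_swap x b); apply: (@clash (~~ k)).
      by rewrite E_swapr E_swap.
    by rewrite negbK.
  have : E k r b w -> edge y b w -> ~~ (edge x y w && edge x b w).
    move=> hw; rewrite (edgeE k) (negbTE (mixed_agree (mixed_swap h) hw)) orbF.
    move=> hyb; rewrite (edge_swap x y) (edge_swap x b); apply: (@clash (~~ k)).
      by rewrite E_swapr E_swap.
    by rewrite negbK.
  move: (edge x y w) (edge x r w) (edge x b w) (edge y r w) (edge y b w)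
    (E k r b w) => [] [] [] [] [] [] //= H1 H2;
  by [have := H1 isT isT | have := H2 isT].
rewrite big1 // in B.
have [[? ? ?] [? ? ?]] := mixed_deg h; lia.
Qed.

(** Suppose [yr] saw only colour k.  A vertex w extending [yr], and extending
    [xy] in the opposite colour, would give a mixed configuration with apex [y]
    in which [r] is the vertex off the minority edge [yxw]; then [xr] would see
    only k, contrary to [xrb].  So the two sets of such w are disjoint, although
    their sizes exceed 7/9 and 1/3. *)
Lemma mixed_bicol k x y r b : mixed k x y r b -> bicol y r.
Proof.
move=> h; case: (h) => hr hb hrb.
have hkyr : sees k y r by apply: (@seesI _ _ _ x); rewrite E_swapr E_swap.
rewrite (bicolE k) hkyr andTb.
apply: contraT => hn.
have B : cdeg (~~ k) x y + deg y r <= 1 * #|V| + \sum_(w : V) 0.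
  rewrite /deg /cdeg -!big_split /=; apply: sum_bound => w.
  case hw : (E (~~ k) x y w) => //=; case hyr: (edge y r w) => //=.
  have hk : E k y r w.
    move: hyr; rewrite (edgeE k) => /orP[//|/seesI]; by rewrite (negbTE hn).
  have hm : mixed (~~ k) y x w r.
    by split; rewrite ?negbK; [rewrite E_swap|rewrite E_swap|rewrite E_swapr].
  by have := mixed_base (mixed_swap hm); rewrite (seesI hrb).
rewrite big1 // in B.
have := cdeg_lb hb; have [[? ? ?] [? ? ?]] := mixed_deg h; lia.
Qed.

Definition bicol3 x y z := [&& bicol x y, bicol x z & bicol y z].

Lemma bicol3_swap x y z : bicol3 x y z = bicol3 y x z.
Proof. by rewrite /bicol3 (bicol_swap x y); congr (_ && _); apply: andbC. Qed.

Lemma mixed_bicol3 k x y r b : mixed k x y r b ->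
  [/\ bicol3 x y r, ~~ sees k x b & ~~ sees k y b].
Proof.
move=> h; case: (h) => hr hb hrb; split; last first.
- exact: mixed_base (mixed_swap h).
- exact: mixed_apex h.
rewrite /bicol3 (mixed_bicol h) !(bicolE k) (seesI hr) (seesI hb) (seesI hrb).
by rewrite (@seesI k x r y) ?andbT // E_swapr.
Qed.

(** An edge [xrw] (or [yrw]) completes a mixed configuration whose minority
    edge is [xyw] or [xyr], according to its colour. *)
Lemma bicol3_neq k x y r w : E k x y r -> E (~~ k) x y w ->
  edge x r w || edge y r w -> bicol3 x y r != bicol3 x y w.
Proof.
have main x' y' : E k x' y' r -> E (~~ k) x' y' w ->
    edge x' r w -> bicol3 x' y' r != bicol3 x' y' w.
  move=> hr hw; rewrite (edgeE k) => /orP[h|h].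
    have hm : mixed (~~ k) x' y' w r by split; rewrite ?negbK // E_swapr.
    have [-> hx _] := mixed_bicol3 hm.
    by rewrite /bicol3 (bicolE k x' r) (negbTE hx) !(andbF, andFb).
  have [-> hx _] := mixed_bicol3 (And3 hr hw h : mixed _ _ _ _ _).
  by rewrite /bicol3 (bicolE k x' w) (negbTE hx) !(andbF, andFb).
move=> hr hw /orP[|h]; first exact: main.
by rewrite !(bicol3_swap x); apply: main; rewrite // E_swap.
Qed.

(** Otherwise, by [bicol3_neq], a vertex w of the opposite colour at [xy] could
    not be joined both to [xr] or [yr] and to [xs] or [ys].  By [clash] it then
    extends at most one of these four pairs.  The opposite colour takes more
    than 1/3 of the vertices, which leaves too little for the four degrees. *)
Lemma bicol3_spread k x y r s :
  E k x y r -> bicol3 x y r -> E k x y s -> bicol3 x y s.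
Proof.
move=> hr fr hs; apply/negPn/negP => fs.
have hb : sees (~~ k) x y.
  by move: fr; rewrite /bicol3 (bicolE k) => /and3P[/andP[]].
have B : deg x r + deg y r + deg x s + deg y s + 3 * cdeg (~~ k) x y
         <= 4 * #|V| + \sum_(w : V) 0.
  rewrite /deg /cdeg big_distrr -!big_split /=; apply: sum_bound => w.
  have Cr : E (~~ k) x y w -> ~~ (edge x r w && edge y r w) by apply: clash.
  have Cs : E (~~ k) x y w -> ~~ (edge x s w && edge y s w) by apply: clash.
  have : E (~~ k) x y w -> ~~ ((edge x r w || edge y r w)
                               && (edge x s w || edge y s w)).
    move=> hw; apply/negP => /andP[/(bicol3_neq hr hw)+ /(bicol3_neq hs hw)].
    by rewrite fr (negbTE fs); case: (bicol3 x y w).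
  move: Cr Cs; move: (edge x r w) (edge y r w) (edge x s w) (edge y s w)
    (E (~~ k) x y w) => [] [] [] [] [] //= H1 H2 H3;
  by [have := H1 isT | have := H2 isT | have := H3 isT].
rewrite big1 // in B.
have [_ ? ?] := deg_edge hr; have [_ ? ?] := deg_edge hs.
have := sees_lb hb; lia.
Qed.

(** Take an edge [xyr] of colour [true].  More than 1/3 of the vertices w make
    [xyw] an edge of colour [false], and [xr] extends by one of them; now apply
    [bicol3_neq]. *)
Lemma bicol3_exists x y : bicol x y -> exists k z, E k x y z /\ bicol3 x y z.
Proof.
case/andP=> /existsP[r hr] hf.
have [w hw hrw] : exists2 w, E false x y w & edge x r w.
  apply/exists_inP; apply: contraT => hn.
  have B : cdeg false x y + deg x r <= 1 * #|V| + \sum_(w : V) 0.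
    rewrite /deg /cdeg -!big_split /=; apply: sum_bound => w.
    move: hn; rewrite negb_exists => /forallP/(_ w).
    by move: (E false x y w) (edge x r w) => [] [].
  rewrite big1 // in B.
  have [_ ? _] := deg_edge hr; have := sees_lb hf; lia.
have := @bicol3_neq true x y r w hr hw; rewrite hrw => /(_ isT).
case fr : (bicol3 x y r) => h; first by exists true, r.
by exists false, w; split; rewrite //; case: (bicol3 x y w) h.
Qed.

Lemma tetra_exists k x y z : E k x y z ->
  exists w, [/\ E k x y w, E k x z w & E k y z w].
Proof.
move=> h.
have /existsP[w /and3P[h1 h2 h3]] :
    [exists w, [&& edge x y w, edge x z w & edge y z w]].
  apply: contraT => hn.
  have B : deg x y + deg x z + deg y z <= 2 * #|V| + \sum_(w : V) 0.
    rewrite /deg -!big_split /=; apply: sum_bound => w.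
    move: hn; rewrite negb_exists => /forallP/(_ w).
    by move: (edge x y w) (edge x z w) (edge y z w) => [] [] [].
  rewrite big1 // in B.
  have [] := deg_edge h; lia.
by exists w; apply: E_mono3.
Qed.

Lemma E_rot k x y z : E k x y z -> E k x z y.
Proof. by rewrite E_swapr. Qed.

Lemma E_cyc k x y z : E k x y z -> E k y z x.
Proof. by move=> h; rewrite E_swapr E_swap. Qed.

Lemma E_forced k x y a b c w : E k x y a -> E k x y b -> E k x y c ->
  edge x y w && [|| edge x a w && edge y a w, edge x b w && edge y b w
                  | edge x c w && edge y c w] <= E k x y w.
Proof.
move=> ha hb hc; case: andP => // -[hxy /or3P[] /andP[h1 h2]].
- by rewrite (E_mono ha).
- by rewrite (E_mono hb).
- by rewrite (E_mono hc).
Qed.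

(** Grow five vertices x, y, z, u, v spanning only triples of colour k, all of
    whose pairs see both colours, and count with [forced_links5]. *)
Lemma no_bicol x y : bicol x y -> False.
Proof.
move=> /bicol3_exists[k [z [hxyz fz]]].
have [u [hxyu hxzu hyzu]] := tetra_exists hxyz.
have fu := bicol3_spread hxyz fz hxyu.
have [/and3P[bxy bxz byz] /and3P[_ bxu byu]] := (fz, fu).
have hxzy : E k x z y by rewrite E_swapr.
have hyzx : E k y z x by rewrite E_swapr E_swap.
have fzy : bicol3 x z y by rewrite /bicol3 bxz bxy bicol_swap.
have bzu : bicol z u by case/and3P: (bicol3_spread hxzy fzy hxzu).
(* The pair [xy] is counted twice: a vertex that extends [xy] but not in colour
   k completes neither [xyz] nor [xyu], so it misses one pair of each.  The
   bound 4/9 on colour k at [xy] then leaves room for v. *)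
have [v [hxyv hxzv hyzv] [hxuv hyuv hzuv]] : exists2 v,
    [/\ E k x y v, E k x z v & E k y z v]
  & [/\ E k x u v, E k y u v & E k z u v].
  have /existsP[v /and4P[h1 h2 h3 /and3P[h4 h5 h6]]] : [exists v,
     [&& edge x y v, edge x z v, edge y z v, edge x u v, edge y u v
       & edge z u v]].
    apply: contraT => hn.
    have B : 2 * deg x y + deg x z + deg y z + deg x u + deg y u + deg z u
         <= 5 * #|V| + cdeg k x y.
      rewrite /deg /cdeg big_distrr -!big_split /=; apply: sum_bound => w.
      move: hn; rewrite negb_exists => /forallP/(_ w).
      have : edge x y w -> edge x z w -> edge y z w -> E k x y w := E_mono hxyz.
      have : edge x y w -> edge x u w -> edge y u w -> E k x y w := E_mono hxyu.
      move: (edge x y w) (edge x z w) (edge y z w) (edge x u w) (edge y u w)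
        (edge z u w) (E k x y w) => [] [] [] [] [] [] [] //= H1 H2;
      by [have := H1 isT isT isT | have := H2 isT isT isT].
    have D1 := cdeg_ub k bxy; have D2 := deg_edge hxyz.
    have D3 := deg_edge hxyu; have D4 := deg_edge hxzu; clear -B D1 D2 D3 D4.
    by case: D2 D3 D4 => ? ? ? [_ ? ?] [_ _ ?]; lia.
  have [? ? ?] := E_mono3 hxyz h1 h2 h3; have [_ ? ?] := E_mono3 hxyu h1 h4 h5.
  by have [_ _ ?] := E_mono3 hxzu h2 h4 h6; exists v; split.
have fv := bicol3_spread hxyz fz hxyv.
have /and3P[_ bxv byv] := fv.
have bzv : bicol z v by case/and3P: (bicol3_spread hxzy fzy hxzv).
have hxuy : E k x u y by rewrite E_swapr.
have fuy : bicol3 x u y by rewrite /bicol3 bxu bxy bicol_swap.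
have buv : bicol u v by case/and3P: (bicol3_spread hxuy fuy hxuv).
have B : 5 * (deg x y + deg x z + deg x u + deg x v + deg y z + deg y u
              + deg y v + deg z u + deg z v + deg u v)
  <= 30 * #|V| + 2 * (cdeg k x y + cdeg k x z + cdeg k x u + cdeg k x v
       + cdeg k y z + cdeg k y u + cdeg k y v + cdeg k z u + cdeg k z v
       + cdeg k u v).
  rewrite /deg /cdeg -!big_split /= !big_distrr /=; apply: sum_bound => w.
  have S := (edge_swap y x, edge_swap z x, edge_swap u x, edge_swap v x,
    edge_swap z y, edge_swap u y, edge_swap v y, edge_swap u z, edge_swap v z,
    edge_swap v u).
  have Exy := E_forced w hxyz hxyu hxyv.
  have Exz := E_forced w hxzy hxzu hxzv.
  have Exu := E_forced w hxuy (E_rot hxzu) hxuv.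
  have Exv := E_forced w (E_rot hxyv) (E_rot hxzv) (E_rot hxuv).
  have Eyz := E_forced w hyzx hyzu hyzv.
  have Eyu := E_forced w (E_cyc hxyu) (E_rot hyzu) hyuv.
  have Eyv := E_forced w (E_cyc hxyv) (E_rot hyzv) (E_rot hyuv).
  have Ezu := E_forced w (E_cyc hxzu) (E_cyc hyzu) hzuv.
  have Ezv := E_forced w (E_cyc hxzv) (E_cyc hyzv) (E_rot hzuv).
  have Euv := E_forced w (E_cyc hxuv) (E_cyc hyuv) (E_cyc hzuv).
  apply: leq_trans (forced_links5 _ _ _ _ _ _ _ _ _ _) _.
  rewrite leq_add2l leq_mul2l /=.
  move: Exy Exz Exu Exv Eyz Eyu Eyv Ezu Ezv Euv; rewrite !S => *.
  by do 9?[apply: leq_add].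
have D := (deg_edge hxyz, deg_edge hxyu, deg_edge hxyv, deg_edge hxzu,
  deg_edge hxzv, deg_edge hxuv).
have U1 := (cdeg_ub k bxy, cdeg_ub k bxz, cdeg_ub k bxu, cdeg_ub k bxv,
  cdeg_ub k byz).
have U2 := (cdeg_ub k byu, cdeg_ub k byv, cdeg_ub k bzu, cdeg_ub k bzv,
  cdeg_ub k buv).
clear -B D U1 U2.
case: U1 U2 => [[[[? ?] ?] ?] ?] [[[[? ?] ?] ?] ?].
by case: D => [[[[[[? ? ?] [_ ? ?]] [_ ? ?]] [_ _ ?]] [_ _ ?]] [_ _ ?]]; lia.
Qed.

Lemma sees_uniq k j x y : sees k x y -> sees j x y -> k = j.
Proof.
have no b : sees b x y -> sees (~~ b) x y -> k = j.
  by move=> h1 h2; case: (@no_bicol x y); rewrite (bicolE b) h1.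
by case: k j no => [] [] // no hk hj; apply: (no _ hk).
Qed.

(** The pairs [xy] and [xz] have a common extension w, and [xw] passes on the
    only colour that a pair can see. *)
Lemma sees_pivot k x y z : sees k x y -> x != z -> sees k x z.
Proof.
move=> hxy xz; have [t ht] := existsP hxy.
have /existsP[w /andP[hyw hzw]] : [exists w, edge x y w && edge x z w].
  apply: contraT => hn.
  have B : deg x y + deg x z <= 1 * #|V| + \sum_(w : V) 0.
    rewrite /deg -!big_split /=; apply: sum_bound => w.
    move: hn; rewrite negb_exists => /forallP/(_ w).
    by move: (edge x y w) (edge x z w) => [] [].
  rewrite big1 // in B; have D1 := deg_gt xz; have [D2 _ _] := deg_edge ht.
  clear -B D1 D2; lia.
have hkw : sees k x w.
  move: hyw; rewrite (edgeE k) => /orP[h|h]; first by rewrite (seesI (E_rot h)).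
  by have := sees_uniq hxy (seesI h); case: (k).
move: hzw; rewrite (edgeE k) => /orP[h|h]; first exact: seesI h.
by have := sees_uniq hkw (seesI (E_rot h)); case: (k).
Qed.

(** With each pair seeing a single colour, turn from [xy] to [ab] through the
    pair [xa]. *)
Lemma one_colour k j x y z a b c : E k x y z -> E j a b c -> k = j.
Proof.
move=> h hj; apply: (@sees_uniq _ _ a b); last exact: seesI hj.
have ab := E_neq hj.
have [ax|xa] := eqVneq x a.
  by move: ab; rewrite -ax; apply: sees_pivot (seesI h).
apply: (sees_pivot _ ab); rewrite sees_swap.
exact: sees_pivot (seesI h) xa.
Qed.

End Colouring.

(** * Tight walks *)

Section Walks.

Variables (k : nat) (V : finType) (G : kgraph k V).

Lemma tight_walk_refl e : e \in edges G -> exists w, tight_walk G e e w.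
Proof.
move=> he; have /eqP ce := forall_inP (edges_uniform G) e he.
have se : size (enum e) = k by rewrite -cardE.
have we : window k (enum e) 0 = e.
  by apply/setP => x; rewrite inE drop0 -se take_size mem_enum.
exists (enum e); split; rewrite ?se ?subnn ?we // => i.
by rewrite leqn0 => /eqP->; rewrite we.
Qed.

Lemma tight_walk_rcons e f w v s x : tight_walk G e f w ->
    drop (size w - k) w = v :: s -> [set y in rcons s x] \in edges G ->
  tight_walk G e [set y in rcons s x] (rcons w x) /\
  drop (size (rcons w x) - k) (rcons w x) = rcons s x.
Proof.
case=> kw -> _ we dw hx.
have sk : k = (size s).+1.
  by have /(congr1 size) := dw; rewrite size_drop subKn.
have E1 : size (rcons w x) - k = (size w - k).+1 by rewrite size_rcons subSn.
have D : drop (size (rcons w x) - k) (rcons w x) = rcons s x.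
  rewrite E1 drop_rcons; last lia.
  by rewrite -add1n -drop_drop dw /= drop0.
have W i : i <= size w - k -> window k (rcons w x) i = window k w i.
  move=> le; rewrite /window drop_rcons; last lia.
  rewrite -cats1 takel_cat // size_drop; lia.
have WL : window k (rcons w x) (size (rcons w x) - k) = [set y in rcons s x].
  by rewrite /window D take_oversize // size_rcons sk.
split=> //; split; rewrite ?WL ?W //; first by rewrite size_rcons ltnW.
move=> i; rewrite E1 leq_eqVlt => /orP[/eqP->|lt]; last by rewrite W // we.
by rewrite -E1 WL.
Qed.

(** Repeating the first vertex of the last window keeps the window as a set
    and rotates it as a sequence. *)
Lemma tight_walk_rot e f w i : tight_walk G e f w -> f \in edges G ->
  exists w', tight_walk G e f w' /\
    drop (size w' - k) w' = rot i (drop (size w - k) w).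
Proof.
move=> hw hf; have [_ _ fE _] := hw.
have sd : size (drop (size w - k) w) = k.
  by case: hw => kw _ _ _; rewrite size_drop subKn.
have ft : f = [set x in drop (size w - k) w].
  by rewrite {1}fE /window take_oversize ?sd.
elim: i => [|i [w' [hw' dw']]]; first by exists w; rewrite rot0.
have [le|lt] := leqP (size (drop (size w - k) w)) i.
  by exists w'; rewrite dw' !rot_oversize // ltnW.
case dE : (rot i (drop (size w - k) w)) => [|v s].
  by move/(congr1 size): dE; rewrite size_rot /= => h; rewrite h in lt.
have rE : [set y in rcons s v] = f.
  by rewrite ft; apply/setP => y; rewrite !inE mem_rcons -dE mem_rot.
rewrite dE in dw'.
have [|h1 h2] := @tight_walk_rcons e f w' v s v hw' dw'; first by rewrite rE.
exists (rcons w' v); rewrite rE in h1; split=> //.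
by rewrite h2 rotS // dE rot1_cons.
Qed.

(** Rotate the last window so that it starts with the only vertex of [f] that
    is not in [g]; the next vertex of the walk is the one of [g] not in [f]. *)
Lemma tight_walk_step e f g : 0 < k -> f \in edges G -> g \in edges G ->
    k.-1 <= #|f :&: g| ->
  (exists w, tight_walk G e f w) -> exists w, tight_walk G e g w.
Proof.
move=> k0 hf hg cfg [w hw].
have [->|ne] := eqVneq g f; first by exists w.
have /eqP cf := forall_inP (edges_uniform G) f hf.
have /eqP cg := forall_inP (edges_uniform G) g hg.
have cI : #|f :&: g| = k.-1.
  apply/eqP; rewrite eqn_leq cfg andbT -ltnS prednK // -cf.
  apply: proper_card; rewrite properE subsetIl subsetI subxx /=.
  apply: contra ne => fg; rewrite eq_sym eqEcard fg cf cg leqnn //.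
have /cards1P[v vE] : #|f :\: g| == 1 by rewrite cardsD cf cI; apply/eqP; lia.
have /cards1P[u uE] : #|g :\: f| == 1.
  by rewrite cardsD cg setIC cI; apply/eqP; lia.
have [kw _ fE _] := hw.
set t := drop (size w - k) w.
have st : size t = k by rewrite size_drop subKn.
have ft : f = [set x in t] by rewrite {1}fE /window take_oversize ?st.
have vt : v \in t.
  have /setDP[+ _] : v \in f :\: g by rewrite vE set11.
  by rewrite {1}ft inE.
have [w' [hw' dw']] := tight_walk_rot (index v t) hw hf.
have tE := rot_index vt; set s := (X in v :: X) in tE.
rewrite -/t tE in dw'.
have us : uniq (v :: s).
  by rewrite -tE rot_uniq; apply/card_uniqP; rewrite st -cf ft cardsE.
have fE' : f = v |: [set x in s].
  by apply/setP=> x; rewrite ft !inE -(mem_rot (index v t)) tE inE.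
have gE : [set y in rcons s u] = g.
  apply/setP => y; rewrite inE mem_rcons inE.
  move: vE uE => /setP/(_ y)+ /setP/(_ y); rewrite !inE fE' !inE.
  move: us; rewrite /= => /andP[vs _].
  have [-> | yv] /= := eqVneq y v.
    by rewrite (negbTE vs) orbF; case: (v == u); case: (v \in g).
  by case: (y == u); case: (y \in s); case: (y \in g).
have [|h _] := @tight_walk_rcons e f w' v s u hw' dw'; first by rewrite gE.
by exists (rcons w' u); rewrite gE in h.
Qed.

End Walks.

(** * The colouring by tight components *)

Section Tetrahedra.

Variables (V : finType) (H : kgraph 3 V).

Definition adj (K L : {set V}) :=
  [&& K \in tetrahedral_edges H, L \in tetrahedral_edges H & 2 < #|K :&: L|].

Definition reached (K0 T : {set V}) :=
  [exists K, [&& K \in tetrahedral_edges H, T \subset K & connect adj K0 K]].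

Definition tcol K0 (k : bool) x y z :=
  ([set x; y; z] \in edges H) && (reached K0 [set x; y; z] == k).

Lemma connect_walk K L : K \in tetrahedral_edges H -> connect adj K L ->
  exists w, tight_walk (tetrahedral H) K L w.
Proof.
move=> hK /connectP[p]; elim/last_ind: p L => [|p M IH] L /=.
  by move=> _ ->; apply: tight_walk_refl.
rewrite rcons_path last_rcons => /andP[hp /and3P[h1 h2 h3]] ->.
apply: (@tight_walk_step _ _ (tetrahedral H) K _ M isT h1 h2 h3).
exact: IH _ hp erefl.
Qed.

Lemma edge_card (T : {set V}) : T \in edges H -> #|T| = 3.
Proof. by move=> hT; apply/eqP; apply: (forall_inP (edges_uniform H)). Qed.

(** Two tetrahedra containing [T] are adjacent, so reachability can be tested
    on any of them; this makes tetrahedra monochromatic. *)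
Lemma reachedE (K0 K T : {set V}) : K \in tetrahedral_edges H -> T \subset K ->
  T \in edges H -> reached K0 T = connect adj K0 K.
Proof.
move=> hK TK /edge_card cT; apply/existsP/idP => [[L /and3P[hL TL c]]|c].
  apply: connect_trans c (connect1 _).
  by rewrite /adj hL hK -cT; apply: subset_leq_card; rewrite subsetI TL.
by exists K; rewrite hK TK.
Qed.

Lemma edge_tetra (K T : {set V}) :
  K \in tetrahedral_edges H -> T \subset K -> #|T| = 3 -> T \in edges H.
Proof.
rewrite inE => /andP[_ /eqP/setP/(_ T)] + TK cT.
by rewrite !inE TK cT andbT.
Qed.

Lemma tetra_triple (K : {set V}) : K \in tetrahedral_edges H ->
  exists x y z, [set x; y; z] \subset K /\ [set x; y; z] \in edges H.
Proof.
move=> hK; have : 2 < #|K| by move: hK; rewrite inE => /andP[/eqP->].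
case/card_gt2P=> x [y [z [[xK yK zK] [xy yz zx]]]].
have sK : [set x; y; z] \subset K by rewrite !subUset !sub1set xK yK.
exists x, y, z; split=> //; apply: edge_tetra hK sK _.
by rewrite -setUA cardsU1 cards2 !inE negb_or xy yz eq_sym zx.
Qed.

Lemma edge_neq x y z : [set x; y; z] \in edges H ->
  [/\ x != y, x != z & y != z].
Proof.
move/edge_card; rewrite -setUA cardsU1 cards2 !inE negb_or.
by move: (x != y) (x != z) (y != z) => [] [] [].
Qed.

Lemma set3_swap (x y z : V) : [set x; y; z] = [set y; x; z].
Proof. by rewrite (setUC [set x]). Qed.

Lemma set3_swapr (x y z : V) : [set x; y; z] = [set x; z; y].
Proof. by rewrite setUAC. Qed.

Lemma tetra_of_edges x y z w :
  [set x; y; z] \in edges H -> [set x; y; w] \in edges H ->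
  [set x; z; w] \in edges H -> [set y; z; w] \in edges H ->
  [set x; y; z; w] \in tetrahedral_edges H.
Proof.
move=> h1 h2 h3 h4; set K := [set x; y; z; w].
have nw : w \notin [set x; y; z].
  have [_ xw yw] := edge_neq h2; have [_ _ zw] := edge_neq h3.
  by rewrite !inE !negb_or !(eq_sym w) xw yw.
have cK : #|K| = 4 by rewrite /K setUC cardsU1 nw (edge_card h1).
rewrite inE cK eqxx /=; apply/eqP/setP => T; rewrite !inE andbC.
apply/andP/andP => [[TK hT]|[TK /eqP cT]]; first by rewrite TK (edge_card hT).
split=> //.
have /cards1P[v vE] : #|K :\: T| == 1 by rewrite cardsD (setIidPr TK) cK cT.
have /setDP[vK vT] : v \in K :\: T by rewrite vE set11.
suff [S hS KS] : exists2 S, S \in edges H & K :\ v \subset S.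
  suff -> : T = S by [].
  apply/eqP; rewrite eqEcard cT (edge_card hS) leqnn andbT.
  by apply: subset_trans KS; rewrite subsetD1 TK.
move: vK; rewrite !inE -!orbA => /or4P[] /eqP->; [exists [set y; z; w] |
  exists [set x; z; w] | exists [set x; y; w] | exists [set x; y; z]] => //;
  by apply/subsetP => t; rewrite !inE; do 4!case: eqP.
Qed.

Lemma tcol_edge K0 x y z : edge (tcol K0) x y z = ([set x; y; z] \in edges H).
Proof.
by rewrite /edge /tcol; case: (_ \in edges H) => //; case: (reached _ _).
Qed.

Lemma codegree_sum K0 x y : x != y -> codegree H x y <= deg (tcol K0) x y.
Proof.
move=> xy; have -> : deg (tcol K0) x y = #|[set w | [set x; y; w] \in edges H]|.
  rewrite /deg -sum1_card [RHS]big_mkcond /=; apply: eq_bigr => w _.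
  by rewrite inE tcol_edge; case: (_ \in edges H).
apply: leq_trans (leq_imset_card (fun w => [set x; y; w]) _).
apply/subset_leq_card/subsetP => T; rewrite inE => /andP[hT sub].
have /set0Pn[w /setDP[wT nw]] : T :\: [set x; y] != set0.
  rewrite setD_eq0; apply/negP => /subset_leq_card.
  by rewrite (edge_card hT) cards2; case: (x != y).
have TE : T = [set x; y; w].
  apply/esym/eqP; rewrite eqEcard subUset sub sub1set wT (edge_card hT) /=.
  move: nw; rewrite !inE negb_or => /andP[wx wy].
  by rewrite -setUA cardsU1 cards2 !inE negb_or xy !(eq_sym _ w) wx wy.
by apply/imsetP; exists w; rewrite // inE -TE.
Qed.

Lemma tcol_swap K0 k x y z : tcol K0 k x y z = tcol K0 k y x z.
Proof. by rewrite /tcol set3_swap. Qed.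

Lemma tcol_swapr K0 k x y z : tcol K0 k x y z = tcol K0 k x z y.
Proof. by rewrite /tcol set3_swapr. Qed.

Lemma tcol_neq K0 k x y z : tcol K0 k x y z -> x != y.
Proof. by case/andP=> /edge_neq[]. Qed.

Lemma tcol_disj K0 k x y z : tcol K0 k x y z -> tcol K0 (~~ k) x y z = false.
Proof. by case/andP=> h1 /eqP <-; rewrite /tcol h1; case: (reached _ _). Qed.

Lemma tcol_mono K0 k x y z w : tcol K0 k x y z -> edge (tcol K0) x y w ->
  edge (tcol K0) x z w -> edge (tcol K0) y z w -> tcol K0 k x y w.
Proof.
rewrite !tcol_edge => /andP[h1 /eqP<-] h2 h3 h4; rewrite /tcol h2 /=.
have hK := tetra_of_edges h1 h2 h3 h4.
rewrite (reachedE K0 hK _ h1) ?subsetUl // (reachedE K0 hK _ h2) //.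
by rewrite (setUAC [set x; y]) subsetUl.
Qed.

End Tetrahedra.

Theorem lemma1p4 (V : finType) (H : kgraph 3 V)
    (hH : (7%:R * #|V|%:R / 9%:R < (min_codegree H)%:R :> rat)%R) :
  tightly_connected (tetrahedral H).
Proof.
move=> K L hK hL.
have V2 : 1 < #|V|.
  apply: leq_trans (max_card (mem K)).
  by move: hK; rewrite inE => /andP[/eqP->].
have md : 7 * #|V| < 9 * min_codegree H.
  move: hH; rewrite Num.Theory.ltr_pdivrMr // -!GRing.Theory.natrM.
  rewrite Num.Theory.ltr_nat.
  by rewrite (mulnC (min_codegree H)).
have dg x y : x != y -> 7 * #|V| < 9 * deg (tcol H K) x y.
  move=> xy; apply: leq_trans md _; rewrite leq_mul2l /=.
  apply: leq_trans (codegree_sum H K xy).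
  have := min_codegreeP H (min_codegree H) V2; rewrite leqnn => /esym.
  by move/forallP/(_ x)/forallP/(_ y)/implyP; apply.
apply: connect_walk => //; apply: contraT => nc.
have [x [y [z [sK hx]]]] := tetra_triple hK.
have [a [b [c [sL ha]]]] := tetra_triple hL.
(* If [L] is not reachable from [K], a triple of [K] has colour [true] and one
   of [L] colour [false]. *)
have := @one_colour V (tcol H K) (@tcol_swap _ H K) (@tcol_swapr _ H K)
  (@tcol_neq _ H K) (@tcol_disj _ H K) (@tcol_mono _ H K) dg
  true false x y z a b c.
rewrite /tcol hx ha (reachedE K hK sK hx) (reachedE K hL sL ha) connect0.
by rewrite (negbTE nc) => /(_ isT isT).
Qed.
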